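(* Let $G=(V,E)$ be a finite connected graph and let $\hat G$ be the graph obtained from $G$ by deleting all pivotal edges of $G$. Let $g\circ f(\hat G)$ denote the simple graph obtained from $\hat G$ by first suppressing degree-$2$ vertices (the graph $\widetilde{\hat G}$) and then removing multiplicities of edges (applying $H\mapsto H'$). Then the negative correlation holds on $G$ for the Arboreal Gas with every choice of parameters $(\beta_e)_{e\in E}$, $\beta_e>0$, if and only if for each connected component of $g\circ f(\hat G)$ the negative correlation holds on that component for the Arboreal Gas with every choice of positive edge parameters.
   Context: Graphs may have parallel edges and loops (these arise in the constructions below); a loop counts as a cycle. Arboreal Gas: a forest on a finite graph $G=(V,E)$ is a subgraph (identified with its edge set) containing no cycle; $\mathcal F$ is the set of forests. For parameters $\beta_e>0$, $e\in E$, the Arboreal Gas is the probability measure $\mathbb{P}_\beta[F]=\frac1{Z_\beta}\prod_{e\in F}\beta_e$ on $\mathcal F$, $Z_\beta=\sum_{F\in\mathcal F}\prod_{e\in F}\beta_e$. $\mathbb{P}_\beta[e_1\cdots e_k]$ is the probability that $e_1,\dots,e_k$ all belong to the forest. The negative correlation holds on $G$ with parameters $\beta$ if $\mathbb{P}_\beta[e_1e_2]\le\mathbb{P}_\beta[e_1]\mathbb{P}_\beta[e_2]$ for all distinct $e_1,e_2\in E$. Pivotal edge: $e\in E$ is pivotal for $G$ if the endpoints of $e$ are not connected in $G\setminus e=(V,E\setminus\{e\})$. Suppressing degree-2 vertices: for a finite graph $H$ with no pivotal edges, define $\tilde H$ as follows. Set $H_0=H$. Given $H_n=(V_n,E_n)$,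 if there is a vertex $u\in V_n$ of degree $2$ incident with two distinct non-loop edges $uv_1,uv_2$ ($v_1=v_2$ allowed), let $V_{n+1}=V_n\setminus\{u\}$ and obtain $E_{n+1}$ from $E_n\setminus\{uv_1,uv_2\}$ by adding a new edge $e_0$ joining $v_1$ and $v_2$ (a loop if $v_1=v_2$); let $f_{n+1}:E_n\to E_{n+1}$ map $uv_1,uv_2$ to $e_0$ and fix all other edges. Stop when there is no such vertex; the final graph is $\tilde H=(\tilde V,\tilde E)$, and $f=f_n\circ\cdots\circ f_1$ is the resulting map from the edges of $H$ to $\tilde E$. Removing multiplicities: for a finite graph $H=(V,E)$, $H'=(V',E')$ is the simple graph with $V'=V$ in which distinct $u,v$ are adjacent iff they are adjacent in $H$ (so parallel edges are merged and loops dropped); $g$ maps an edge with endpoints $u,v$ to $uv$. *)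

(* Defs.v *)
From HB Require Import structures.
From mathcomp Require Import all_boot all_order all_algebra.
From mathcomp Require Import boolp reals.

Set Implicit Arguments.
Unset Strict Implicit.
Unset Printing Implicit Defensive.

Import Order.TTheory GRing.Theory Num.Theory.
Local Open Scope ring_scope.

(* A finite multigraph, with vertices and edges taken from ambient finite types
   (as {group gT} lives in gT).  An edge has one endpoint if it is a loop and
   two otherwise; the value of [ends] outside [edges] is irrelevant. *)
Record mgraph (V E : finType) := MGraph {
  verts : {set V};
  edges : {set E};
  ends : E -> {set V};
  ends_sub : forall e, e \in edges -> ends e \subset verts;
  ends_card : forall e, e \in edges -> (0 < #|ends e| <= 2)%N
}.

Section Graphs.
Variables V E : finType.
Implicit Types (H : mgraph V E) (x y u v : V) (e : E) (F : {set E}).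

Definition adj H : rel V :=
  fun x y => [exists e in edges H, ends H e == [set x; y]].

Definition connected_graph H : Prop :=
  verts H != set0 /\ {in verts H &, forall x y, connect (adj H) x y}.

Definition loop H e : bool := #|ends H e| == 1%N.

(* Loops count twice. *)
Definition degree H u : nat :=
  (#|[set e in edges H | u \in ends H e]| +
   #|[set e in edges H | loop H e && (u \in ends H e)]|)%N.

Lemma del_edges_sub H F e :
  e \in edges H :\: F -> ends H e \subset verts H.
Proof. by case/setDP=> /ends_sub. Qed.

Lemma del_edges_card H F e :
  e \in edges H :\: F -> (0 < #|ends H e| <= 2)%N.
Proof. by case/setDP=> /ends_card. Qed.

Definition del_edges H F : mgraph V E :=
  MGraph (@del_edges_sub H F) (@del_edges_card H F).

Lemma induced_sub H (C : {set V}) e :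
  e \in [set e in edges H | ends H e \subset C] ->
  ends H e \subset verts H :&: C.
Proof. by rewrite inE subsetI => /andP[/ends_sub-> ->]. Qed.

Lemma induced_card H (C : {set V}) e :
  e \in [set e in edges H | ends H e \subset C] -> (0 < #|ends H e| <= 2)%N.
Proof. by rewrite inE => /andP[/ends_card]. Qed.

Definition induced H (C : {set V}) : mgraph V E :=
  MGraph (@induced_sub H C) (@induced_card H C).

Definition component_sets H : {set {set V}} :=
  equivalence_partition (connect (adj H)) (verts H).

Definition pivotal H e : bool :=
  [exists x in ends H e, exists y in ends H e,
    ~~ connect (adj (del_edges H [set e])) x y].

Definition delete_pivotal H : mgraph V E :=
  del_edges H [set e in edges H | pivotal H e].

(* The list (v_1, e_1), ..., (v_k, e_k), k >= 1, with distinct v_i and distinct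
   e_i, where e_i joins v_i to v_{i+1} and e_k joins v_k to v_1.  A loop is the
   case k = 1, a pair of parallel edges the case k = 2. *)
Definition graph_cycle H (c : seq (V * E)) : bool :=
  [&& c != [::], uniq [seq p.1 | p <- c], uniq [seq p.2 | p <- c],
      all (fun p => p.2 \in edges H) c &
      cycle (fun p q => ends H p.2 == [set p.1; q.1]) c].

Definition forest H F : Prop :=
  F \subset edges H /\
  forall c, graph_cycle H c -> ~~ all (fun p => p.2 \in F) c.

(* In [H], [u] has degree 2 and is incident with the distinct non-loop edges
   [e1] = u v1 and [e2] = u v2. *)
Definition suppressible H u (e1 e2 : E) v1 v2 : bool :=
  [&& u \in verts H, degree H u == 2%N,
      [&& e1 \in edges H, e2 \in edges H & e1 != e2],
      (v1 != u) && (v2 != u),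
      ends H e1 == [set u; v1] & ends H e2 == [set u; v2]].

(* The new edge [e0] may reuse the name of any element of [E] which is not one
   of the remaining edges, in particular that of [e1] or [e2]. *)
Definition suppress_step H H' : Prop :=
  exists u e1 e2 v1 v2 e0,
  [/\ suppressible H u e1 e2 v1 v2,
      verts H' = verts H :\ u,
      e0 \notin edges H :\: [set e1; e2] /\
      edges H' = e0 |: (edges H :\: [set e1; e2]),
      ends H' e0 = [set v1; v2] &
      {in edges H :\: [set e1; e2], ends H' =1 ends H}].

(* [suppression H Ht]: a run of the suppression procedure started at [H] stops
   at [Ht].  The vertex suppressed at each step is arbitrary. *)
Inductive suppression : mgraph V E -> mgraph V E -> Prop :=
| suppression_stop H :
    (forall u e1 e2 v1 v2, ~~ suppressible H u e1 e2 v1 v2) -> suppression H H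
| suppression_next H H' Ht :
    suppress_step H H' -> suppression H' Ht -> suppression H Ht.

Lemma suppress_step_exists H u e1 e2 v1 v2 :
  suppressible H u e1 e2 v1 v2 -> exists H', suppress_step H H'.
Proof.
move=> sup; have := sup.
case/and5P=> uH /eqP degu /and3P[e1H e2H ne12] /andP[nv1 nv2].
case/andP=> /eqP end1 /eqP end2.
have inc : [set e in edges H | u \in ends H e] = [set e1; e2].
  apply/esym/eqP; rewrite eqEcard; apply/andP; split.
    apply/subsetP=> e; rewrite !inE => /orP[] /eqP->.
      by rewrite e1H end1 set21.
    by rewrite e2H end2 set21.
  by rewrite cards2 ne12 -degu leq_addr.
pose ed := e1 |: (edges H :\: [set e1; e2]).
pose en e := if e == e1 then [set v1; v2] else ends H e.
have v1H : v1 \in verts H.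
  by apply: (subsetP (ends_sub e1H)); rewrite end1 set22.
have v2H : v2 \in verts H.
  by apply: (subsetP (ends_sub e2H)); rewrite end2 set22.
have sub e : e \in ed -> en e \subset verts H :\ u.
  rewrite /ed /en in_setU1; case: eqVneq => [_ _|ne1 /= /setDP[eH eN]].
    by apply/subsetP=> x; rewrite !inE => /orP[] /eqP->; apply/andP; split.
  rewrite subsetD1 ends_sub //=; apply: contra eN => ue.
  by rewrite -inc inE eH.
have crd e : e \in ed -> (0 < #|en e| <= 2)%N.
  rewrite /ed /en in_setU1; case: eqVneq => [_ _|_ /= /setDP[/ends_card]//].
  by rewrite cards2; case: (v1 != v2).
exists (MGraph sub crd), u, e1, e2, v1, v2, e1; split=> //=.
- by rewrite !inE eqxx.
- by rewrite /en eqxx.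
- by move=> e; rewrite /en !inE; case: eqVneq.
Qed.

Lemma suppression_exists H : exists Ht, suppression H Ht.
Proof.
have [n] := ubnP #|verts H|; elim: n H => // n IHn H ltHn.
have [[u [e1 [e2 [v1 [v2 sup]]]]]|stop] := pselect
  (exists u e1 e2 v1 v2, suppressible H u e1 e2 v1 v2); last first.
  exists H; apply: suppression_stop => u e1 e2 v1 v2.
  by apply/negP=> sup; apply: stop; exists u, e1, e2, v1, v2.
have [H' stepH] := suppress_step_exists sup.
have [w [_ [_ [_ [_ [_ [/and5P[wH _ _ _ _] vH' _ _ _]]]]]]] := stepH.
have [|Ht runH'] := IHn H'; first by rewrite vH'; move: ltHn; rewrite (cardsD1 w) wH.
by exists Ht; apply: suppression_next stepH runH'.
Qed.

Lemma remove_mult_sub H uv :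
  uv \in [set ends H e | e in edges H & ~~ loop H e] -> uv \subset verts H.
Proof. by case/imsetP=> e; rewrite inE => /andP[/ends_sub sub _] ->. Qed.

Lemma remove_mult_card H uv :
  uv \in [set ends H e | e in edges H & ~~ loop H e] -> (0 < #|uv| <= 2)%N.
Proof. by case/imsetP=> e; rewrite inE => /andP[/ends_card crd _] ->. Qed.

(* The edge of the simple graph joining u and v is the pair [set u; v]. *)
Definition remove_mult H : mgraph V {set V} :=
  MGraph (ends := id) (@remove_mult_sub H) (@remove_mult_card H).

Section ArborealGas.
Variable R : realType.
Implicit Type beta : E -> R.

Definition forest_weight beta F : R := \prod_(e in F) beta e.

Definition partition_function H beta : R :=
  \sum_(F : {set E} | `[< forest H F >]) forest_weight beta F.

Definition arboreal_gas H beta F : R :=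
  if `[< forest H F >] then forest_weight beta F / partition_function H beta
  else 0.

(* The probability that all the edges of [A] belong to the forest. *)
Definition prob_edges H beta (A : {set E}) : R :=
  \sum_(F : {set E} | A \subset F) arboreal_gas H beta F.

Definition negative_correlation H beta : Prop :=
  {in edges H &, forall e1 e2, e1 != e2 ->
    prob_edges H beta [set e1; e2] <=
    prob_edges H beta [set e1] * prob_edges H beta [set e2]}.

Definition always_negative_correlation H : Prop :=
  forall beta, {in edges H, forall e, 0 < beta e} -> negative_correlation H beta.

End ArborealGas.
End Graphs.

(* Main.v *)
Require Import Defs.
From mathcomp Require Import all_boot all_order all_algebra.
From mathcomp Require Import boolp reals.
From mathcomp Require Import ring lra.

(** Negative correlation only depends on the family of forests, and in the form
    [Z(e1 e2) Z <= Z(e1) Z(e2)], where [Z(X)] sums the weights of the forests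
    containing [X], it makes sense for any family of sets.  If the family is a
    product over [A] and its complement, so is [Z]; hence edges on different
    sides are independent, and negative correlation can be tested on each side.
    This covers pivotal edges, loops and connected components.  Let [a] and [b]
    sum over the sets [F], not using the edge [e0], such that [e0 + F], resp.
    [F], is a forest.  The condition for [e0] and another edge [y] is
    [a(y) b <= a b(y)].  Two parallel edges replace [e0] when their weights add
    up to that of [e0], and two edges in series when
    [b1 * b2 = b0 * (1 + b1 + b2)]; in both cases [Z] is only multiplied by a
    constant, and the condition for one of the two edges and [y] is the same.
    The two new edges themselves are never in a common forest, respectively
    satisfy the inequality because [a <= b]. *)

Set Implicit Arguments.
Unset Strict Implicit.
Unset Printing Implicit Defensive.

Import Order.TTheory GRing.Theory Num.Theory.
Local Open Scope ring_scope.

(** * Negative correlation for families of sets *)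

Section IndependenceSystems.
Variables (R : realType) (E : finType).
Implicit Types (S A P F X : {set E}) (I : pred {set E}) (beta : E -> R).

(** The ground set and the family are separate arguments: deleting an element shrinks [S],
    contracting [e] replaces [I] by [fun F => I (e |: F)]. *)
Definition Zsum S I beta X : R :=
  \sum_(F : {set E} | [&& F \subset S, I F & X \subset F]) \prod_(e in F) beta e.

Definition nc_pair S I beta e1 e2 : Prop :=
  Zsum S I beta [set e1; e2] * Zsum S I beta set0 <=
  Zsum S I beta [set e1] * Zsum S I beta [set e2].

Definition nc_system S I : Prop :=
  forall beta, {in S, forall e, 0 < beta e} ->
  {in S &, forall e1 e2, e1 != e2 -> nc_pair S I beta e1 e2}.

Lemma nc_pairC S I beta e1 e2 : nc_pair S I beta e1 e2 -> nc_pair S I beta e2 e1.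
Proof. by rewrite /nc_pair setUC [X in _ <= X]mulrC. Qed.

Lemma eq_Zsum S I I' beta beta' X :
  {in powerset S, I =1 I'} -> {in S, beta =1 beta'} ->
  Zsum S I beta X = Zsum S I' beta' X.
Proof.
move=> eqI eqb; apply: eq_big => [F|F /and3P[sFS _ _]].
  by case sFS: (F \subset S) => //=; rewrite eqI ?powersetE.
by apply: eq_bigr => e eF; rewrite eqb // (subsetP sFS).
Qed.

Lemma Zsum_ge0 S I beta X : {in S, forall e, 0 < beta e} -> 0 <= Zsum S I beta X.
Proof.
move=> bpos; apply: sumr_ge0 => F /and3P[sFS _ _].
by apply: prodr_ge0 => e eF; rewrite ltW // bpos // (subsetP sFS).
Qed.

Lemma Zsum0_gt0 S I beta :
  {in S, forall e, 0 < beta e} -> I set0 -> 0 < Zsum S I beta set0.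
Proof.
move=> bpos I0; rewrite /Zsum (bigD1 set0) /=; last by rewrite sub0set I0 sub0set.
rewrite big_set0 ltr_wpDr //; apply: sumr_ge0 => F /andP[/and3P[sFS _ _] _].
by apply: prodr_ge0 => e eF; rewrite ltW // bpos // (subsetP sFS).
Qed.

Lemma Zsum_le S I I' beta X : {in S, forall e, 0 < beta e} ->
  (forall F, F \subset S -> I F -> I' F) -> Zsum S I beta X <= Zsum S I' beta X.
Proof.
move=> bpos sub; rewrite /Zsum big_mkcond [leRHS]big_mkcond; apply: ler_sum => F _.
case: ifP => [/and3P[sFS IF ->]|_]; first by rewrite sFS (sub F).
case: ifP => // /and3P[sFS _ _].
by apply: prodr_ge0 => e eF; rewrite ltW // bpos // (subsetP sFS).
Qed.

Lemma setD1_notin (e : E) X : e \notin X -> X :\ e = X.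
Proof. by move=> eX; apply/setDidPl; rewrite disjoint_sym disjoints1. Qed.

Lemma subset_setU1 (e : E) S F : (F \subset e |: S) = (F :\ e \subset S).
Proof. by rewrite -subDset. Qed.

(** The sets containing [e] are indexed by what is left after removing it. When [e] lies in [X] the
    first sum is empty, since [e] is not in [S]. *)
Lemma Zsum_split S I beta X e : e \notin S ->
  Zsum (e |: S) I beta X = Zsum S I beta X +
    beta e * Zsum S (fun F => I (e |: F)) beta (X :\ e).
Proof.
move=> eS; rewrite /Zsum (bigID (fun F : {set E} => e \in F)) /= addrC; congr (_ + _).
  apply: eq_bigl => F; case eF: (e \in F).
    rewrite andbF; case sFS: (F \subset S) => //=.
    by rewrite (subsetP sFS) in eS.
  rewrite andbT; congr (_ && _).
  by rewrite subset_setU1 setD1_notin ?eF.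
rewrite mulr_sumr (reindex_onto (fun F => e |: F) (fun F => F :\ e)) /=; last first.
  by move=> F /andP[_ eF]; rewrite setD1K.
apply: eq_big => [F|F].
  rewrite setU11 andbT; case: (boolP (e \in F)) => eF.
    have -> : (F \subset S) = false.
      by apply: contraNF eS => /subsetP; apply.
    rewrite andbC /=; case: eqVneq => // eq.
    by move: eF; rewrite -eq !inE eqxx.
  by rewrite setU1K // eqxx andbT subset_setU1 setU1K // subset_setU1.
case/andP=> _ /eqP eq; rewrite big_setU1 //=.
by rewrite -eq !inE eqxx.
Qed.

Lemma Zsum_out S I beta X e : e \notin S -> e \notin X ->
  Zsum (e |: S) I beta X = Zsum S I beta X +
    beta e * Zsum S (fun F => I (e |: F)) beta X.
Proof.
move=> eS eX; rewrite Zsum_split //; congr (_ + _ * Zsum _ _ _ _).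
by rewrite setD1_notin.
Qed.

Lemma Zsum_in S I beta X e : e \notin S -> e \notin X ->
  Zsum (e |: S) I beta (e |: X) =
    beta e * Zsum S (fun F => I (e |: F)) beta X.
Proof.
move=> eS eX; rewrite Zsum_split // setU1K // /Zsum big1 ?add0r // => F.
case/and3P=> sFS _; rewrite subUset sub1set => /andP[eF _].
by rewrite (subsetP sFS) in eS.
Qed.

(** * Direct sums of families (separators, in the language of matroids) *)

Definition separator S I A :=
  forall F, F \subset S -> I F = I (F :&: A) && I (F :\: A).

(** A set [F] corresponds to the pair [(F :&: A, F :\: A)], and weights multiply over disjoint
    unions. *)
Lemma Zsum_separator S I A beta X : separator S I A ->
  Zsum S I beta X =
  Zsum (S :&: A) I beta (X :&: A) * Zsum (S :\: A) I beta (X :\: A).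
Proof.
move=> sep; rewrite /Zsum big_distrlr /= pair_big_dep /=.
rewrite (reindex_onto (fun p : {set E} * {set E} => p.1 :|: p.2)
  (fun F => (F :&: A, F :\: A))) /=; last by move=> F _; rewrite setID.
apply: eq_big => [[F1 F2]|[F1 F2]] /=.
  apply/andP/idP => [[/and3P[sFS]]|].
    rewrite (sep _ sFS) => /andP[I1 I2] sX /eqP[e1 e2].
    have /and3P[-> -> ->] : [&& F1 \subset S :&: A, I F1 & X :&: A \subset F1].
      by rewrite -e1 I1 !setSI.
    by rewrite -e2 I2 !setSD.
  case/andP=> /and3P[]; rewrite subsetI => /andP[s1S s1A] I1 sX1.
  case/and3P; rewrite subsetD => /andP[s2S s2A] I2 sX2.
  have e1 : (F1 :|: F2) :&: A = F1.
    rewrite setIUl (setIidPl s1A); move: s2A; rewrite -setI_eq0 => /eqP->.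
    by rewrite setU0.
  have e2 : (F1 :|: F2) :\: A = F2.
    rewrite setDUl (setDidPl s2A); move: s1A; rewrite -setD_eq0 => /eqP->.
    by rewrite set0U.
  have s12 : F1 :|: F2 \subset S by rewrite subUset s1S.
  rewrite s12 (sep _ s12) e1 e2 I1 I2 eqxx; split=> //=.
  by rewrite -(setID X A) setUSS.
by case/andP=> _ /eqP[e1 e2]; rewrite (big_setID A) /= e1 e2.
Qed.

Lemma Zsum_separator_compl S I A beta X :
  separator S I A -> X \subset A ->
  Zsum S I beta X = Zsum (S :&: A) I beta X * Zsum (S :\: A) I beta set0.
Proof.
move=> sep sXA; rewrite (Zsum_separator _ _ sep) (setIidPl sXA).
by move: sXA; rewrite -setD_eq0 => /eqP->.
Qed.

(** Both sides factor into the same four sums, so equality holds: the two elements are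
    independent. *)
Lemma nc_pair_separated S I A beta e1 e2 :
  separator S I A -> e1 \in A -> e2 \notin A -> nc_pair S I beta e1 e2.
Proof.
move=> sep e1A e2A; rewrite /nc_pair !(Zsum_separator _ _ sep).
have d1 : [set e1] :&: A = [set e1] by apply/setIidPl; rewrite sub1set.
have d1' : [set e1] :\: A = set0 by apply/eqP; rewrite setD_eq0 sub1set.
have d2 : [set e2] :\: A = [set e2] by apply/setDidPl; rewrite disjoints1.
have d2' : [set e2] :&: A = set0 by apply/eqP; rewrite setI_eq0 disjoints1.
rewrite setIUl setDUl d1 d1' d2 d2' setU0 !set0U set0I set0D.
by rewrite le_eqVlt; apply/orP; left; apply/eqP; ring.
Qed.

(** The sum over subsets of [S :\: A] enters both sides through its square, a nonnegative factor. *)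
Lemma nc_pair_within S I A beta e1 e2 :
  {in S, forall e, 0 < beta e} -> separator S I A -> e1 \in A -> e2 \in A ->
  nc_pair (S :&: A) I beta e1 e2 -> nc_pair S I beta e1 e2.
Proof.
move=> bpos sep e1A e2A; rewrite /nc_pair => nc.
rewrite !(Zsum_separator_compl _ sep) ?sub0set ?sub1set // ?subUset ?sub1set ?e1A //.
rewrite mulrACA [leRHS]mulrACA ler_wpM2r // -expr2 exprn_ge0 // Zsum_ge0 //.
by move=> e /setDP[/bpos].
Qed.

(** The factor coming from [S :\: A] can be cancelled: it is positive because the empty set belongs
    to the family. *)
Lemma nc_system_separator S I A :
  I set0 -> separator S I A -> nc_system S I -> nc_system (S :&: A) I.
Proof.
move=> I0 sep nc beta bpos e1 e2 /setIP[e1S e1A] /setIP[e2S e2A] ne.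
(* [beta] is only known to be positive on [S :&: A]; any positive value serves outside [A]. *)
pose beta' e := if e \in A then beta e else 1.
have bpos' : {in S, forall e, 0 < beta' e}.
  by move=> e eS; rewrite /beta'; case: ifP => // eA; rewrite bpos // inE eS.
have eqZ X : Zsum (S :&: A) I beta X = Zsum (S :&: A) I beta' X.
  by apply: eq_Zsum => // e /setIP[_ eA]; rewrite /beta' eA.
have := nc beta' bpos' e1 e2 e1S e2S ne.
rewrite /nc_pair !eqZ.
rewrite !(Zsum_separator_compl _ sep) ?sub0set ?sub1set // ?subUset ?sub1set ?e1A //.
rewrite mulrACA [leRHS]mulrACA ler_pM2r // -expr2 exprn_gt0 // Zsum0_gt0 //.
by move=> e /setDP[/bpos'].
Qed.

(** An element of [P] is independent of every other one, so only pairs outside [P] matter; these are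
    tested inside the complement of [P], again a separator. *)
Lemma nc_systemD S I P : I set0 -> separator S I P ->
  {in S :&: P, forall e, separator S I [set e]} ->
  nc_system S I <-> nc_system (S :\: P) I.
Proof.
move=> I0 sepP sep1.
have sepC : separator S I (~: P).
  by move=> F FS; rewrite (sepP F FS) andbC [F :\: ~: P]setDE setCK -setDE.
split=> nc; first by rewrite setDE; apply: nc_system_separator.
move=> beta bpos e1 e2 e1S e2S ne.
case: (boolP (e1 \in P)) => e1P.
  by apply: (nc_pair_separated _ (sep1 e1 _)); rewrite !inE ?e1S ?eqxx // eq_sym.
case: (boolP (e2 \in P)) => e2P.
  apply: nc_pairC; apply: (nc_pair_separated _ (sep1 e2 _)); rewrite !inE ?e2S //.
apply: (nc_pair_within bpos sepC); rewrite ?inE //.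
rewrite -setDE; apply: nc => //; rewrite ?inE ?e1P ?e2P //.
by move=> e /setDP[/bpos].
Qed.

(** * Singling out one or two elements *)

Lemma nc_pair_out S I beta e x y : e \notin S -> x \in S -> y \in S ->
  let b X := Zsum S I beta X in
  let a X := Zsum S (fun F => I (e |: F)) beta X in
  nc_pair (e |: S) I beta x y <->
  (b [set x; y] + beta e * a [set x; y]) * (b set0 + beta e * a set0) <=
  (b [set x] + beta e * a [set x]) * (b [set y] + beta e * a [set y]).
Proof.
move=> eS xS yS b a.
have ex : e != x by apply: contraNneq eS => ->.
have ey : e != y by apply: contraNneq eS => ->.
by rewrite /nc_pair !Zsum_out ?inE ?negb_or ?ex.
Qed.

(** After division by [beta e], the term [beta e * a set0 * a [set y]] occurs on both sides and
    cancels, which removes [beta e] from the condition. *)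
Lemma nc_pair_in S I beta e y : e \notin S -> y \in S -> 0 < beta e ->
  let b X := Zsum S I beta X in
  let a X := Zsum S (fun F => I (e |: F)) beta X in
  nc_pair (e |: S) I beta e y <-> a [set y] * b set0 <= a set0 * b [set y].
Proof.
move=> eS yS be b a.
have ey : e != y by apply: contraNneq eS => ->.
have Ze : Zsum (e |: S) I beta [set e] = beta e * a set0.
  by rewrite -Zsum_in ?inE // setU0.
rewrite /nc_pair Zsum_in ?inE // Ze !Zsum_out ?inE // -/(a _) -/(b _) -/(a _) -/(b _).
rewrite -!mulrA ler_pM2l //.
have -> : a [set y] * (b set0 + beta e * a set0) =
  a [set y] * b set0 + beta e * a set0 * a [set y] by ring.
have -> : a set0 * (b [set y] + beta e * a [set y]) =
  a set0 * b [set y] + beta e * a set0 * a [set y] by ring.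
by rewrite lerD2r.
Qed.

Section TwoElements.
Variables (S : {set E}) (I I' : pred {set E}) (e0 e1 e2 : E).
Hypotheses (e0S : e0 \notin S) (e1S : e1 \notin S) (e2S : e2 \notin S).
Hypothesis e12 : e1 != e2.

Lemma notin_setU1 e e' : e != e' -> e \notin S -> e \notin e' |: S.
Proof. by move=> ne eS; rewrite !inE negb_or ne. Qed.

Let e1S2 := notin_setU1 e12 e1S.

Lemma setU2_ne e x : e \notin S -> x \in S -> e != x.
Proof. by move=> eS xS; apply: contraNneq eS => ->. Qed.

(** The inequality is homogeneous of degree two in the sums, so a common factor [s] cancels. Towards
    the other elements, [e1] and [e2] then act like a single [e0] of weight [k]. *)
Lemma nc_pair_scale (s k : R) (b a : {set E} -> R) beta beta' x y :
  x \in S -> y \in S -> 0 < s -> beta' e0 = k ->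
  (forall X, X \subset S -> Zsum S I' beta' X = b X) ->
  (forall X, X \subset S -> Zsum S (fun F => I' (e0 |: F)) beta' X = a X) ->
  (forall X, X \subset S ->
     Zsum (e1 |: (e2 |: S)) I beta X = s * (b X + k * a X)) ->
  nc_pair (e1 |: (e2 |: S)) I beta x y <-> nc_pair (e0 |: S) I' beta' x y.
Proof.
move=> xS yS s0 bk eb ea eZ; rewrite (nc_pair_out _ _ e0S) // bk.
rewrite /nc_pair !eZ ?eb ?ea ?subUset ?sub1set ?xS ?yS ?sub0set //.
by rewrite mulrACA [X in _ <= X]mulrACA ler_pM2l ?mulr_gt0.
Qed.

Lemma Zsum_out2 beta X : X \subset S ->
  Zsum (e1 |: (e2 |: S)) I beta X =
  Zsum S I beta X + beta e2 * Zsum S (fun F => I (e2 |: F)) beta X +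
  beta e1 * (Zsum S (fun F => I (e1 |: F)) beta X +
    beta e2 * Zsum S (fun F => I (e1 |: (e2 |: F))) beta X).
Proof.
move=> sXS.
have e1X : e1 \notin X by apply: contraNN e1S; apply: (subsetP sXS).
have e2X : e2 \notin X by apply: contraNN e2S; apply: (subsetP sXS).
by rewrite !Zsum_out.
Qed.

Lemma nc_pair_in2 beta y : y \in S -> 0 < beta e1 ->
  let b X := Zsum S I beta X +
    beta e2 * Zsum S (fun F => I (e2 |: F)) beta X in
  let a X := Zsum S (fun F => I (e1 |: F)) beta X +
    beta e2 * Zsum S (fun F => I (e1 |: (e2 |: F))) beta X in
  nc_pair (e1 |: (e2 |: S)) I beta e1 y <->
  a [set y] * b set0 <= a set0 * b [set y].
Proof.
move=> yS be b a; have yS2 : y \in e2 |: S by rewrite setU1r.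
have e2y := setU2_ne e2S yS.
by have := nc_pair_in I e1S2 yS2 be; rewrite /= !Zsum_out ?inE //.
Qed.

Lemma Zsum_in2 beta :
  Zsum (e1 |: (e2 |: S)) I beta [set e1; e2] =
  beta e1 * (beta e2 * Zsum S (fun F => I (e1 |: (e2 |: F))) beta set0).
Proof.
rewrite Zsum_in ?in_set1 //; congr (_ * _).
by rewrite -(@Zsum_in S (fun F => I (e1 |: F)) beta set0 e2) ?in_set0 // setU0.
Qed.

Lemma Zsum_in1 beta :
  Zsum (e1 |: (e2 |: S)) I beta [set e1] =
  beta e1 * (Zsum S (fun F => I (e1 |: F)) beta set0 +
    beta e2 * Zsum S (fun F => I (e1 |: (e2 |: F))) beta set0).
Proof.
rewrite -(@Zsum_out S (fun F => I (e1 |: F)) beta set0 e2) ?in_set0 //.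
by rewrite -(@Zsum_in (e2 |: S) I beta set0 e1) ?in_set0 // setU0.
Qed.

End TwoElements.

(** * Two elements in series *)

Section Series.
Variables (S : {set E}) (I I' : pred {set E}) (e0 : E).
Hypothesis e0S : e0 \notin S.
Hypothesis I'0 : {in powerset S, I =1 I'}.
Hypothesis I'sub : forall F, F \subset S -> I' (e0 |: F) -> I' F.

Section Pairs.
Variables (e1 e2 : E) (beta beta' : E -> R).
Hypotheses (e1S : e1 \notin S) (e2S : e2 \notin S) (e12 : e1 != e2).
(** For forests, one of the two edges at a vertex of degree 2 is pendant and never closes a cycle;
    both together act as the edge [e0]. *)
Hypothesis I1 : {in powerset S, forall F, I (e1 |: F) = I F}.
Hypothesis I2 : {in powerset S, forall F, I (e2 |: F) = I F}.
Hypothesis I12 : {in powerset S, forall F, I (e1 |: (e2 |: F)) = I' (e0 |: F)}.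
Hypothesis eqb : {in S, beta =1 beta'}.
Hypotheses (b0 : 0 < beta' e0) (b1 : 0 < beta e1) (b2 : 0 < beta e2).

Let b X := Zsum S I' beta' X.
Let a X := Zsum S (fun F => I' (e0 |: F)) beta' X.

Let eq_b0 X : Zsum S I beta X = b X.
Proof. exact: eq_Zsum. Qed.
Let eq_b1 X : Zsum S (fun F => I (e1 |: F)) beta X = b X.
Proof. by apply: eq_Zsum => // F FS; rewrite I1 ?I'0. Qed.
Let eq_b2 X : Zsum S (fun F => I (e2 |: F)) beta X = b X.
Proof. by apply: eq_Zsum => // F FS; rewrite I2 ?I'0. Qed.
Let eq_a X : Zsum S (fun F => I (e1 |: (e2 |: F))) beta X = a X.
Proof. by apply: eq_Zsum => // F FS; rewrite I12. Qed.

(** Deleting [e1] gives [(1 + beta e2) * b], contracting it gives [b + beta e2 * a]. The products [b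
    set0 * b [set y]] cancel, and a positive multiple of the condition for [e0] remains. *)
Lemma nc_pair_series_in y : y \in S ->
  nc_pair (e1 |: (e2 |: S)) I beta e1 y <-> nc_pair (e0 |: S) I' beta' e0 y.
Proof.
move=> yS; rewrite (nc_pair_in _ e0S) // -/(a _) -/(b _) -/(a _) -/(b _).
rewrite nc_pair_in2 // !eq_b0 !eq_b1 !eq_b2 !eq_a.
have c : 0 < (1 + beta e2) * beta e2 by rewrite mulr_gt0 // addr_gt0.
rewrite -subr_ge0 (_ : _ - _ = (1 + beta e2) * beta e2 *
  (a set0 * b [set y] - a [set y] * b set0)); last by ring.
by rewrite pmulr_rge0 // subr_ge0.
Qed.

Hypothesis bk : beta e1 * beta e2 = beta' e0 * (1 + beta e1 + beta e2).

(** Sets with at most one of the two elements contribute [(1 + beta e1 + beta e2) * b], sets with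
    both [beta e1 * beta e2 * a]; by [bk] the total is [1 + beta e1 + beta e2] times the sum for
    [e0]. *)
Lemma nc_pair_series_out x y : x \in S -> y \in S ->
  nc_pair (e1 |: (e2 |: S)) I beta x y <-> nc_pair (e0 |: S) I' beta' x y.
Proof.
move=> xS yS; apply: (@nc_pair_scale S I I' e0 e1 e2 e0S
  (1 + beta e1 + beta e2) (beta' e0) b a) => //.
  by rewrite !addr_gt0.
move=> X XS; rewrite Zsum_out2 // eq_b0 eq_b1 eq_b2 eq_a.
rewrite [RHS](_ : _ = (1 + beta e1 + beta e2) * b X +
  beta' e0 * (1 + beta e1 + beta e2) * a X); last by ring.
by rewrite -bk; ring.
Qed.

Lemma nc_pair_series12 :
  {in S, forall e, 0 < beta e} -> nc_pair (e1 |: (e2 |: S)) I beta e1 e2.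
Proof.
move=> bpos; rewrite /nc_pair Zsum_in2 // Zsum_in1 //.
rewrite Zsum_out2 ?sub0set //.
have -> : Zsum (e1 |: (e2 |: S)) I beta [set e2] =
  beta e2 * (b set0 + beta e1 * a set0).
  rewrite setUCA Zsum_in1 // 1?eq_sym //.
  rewrite eq_b2; congr (_ * (_ + _ * _)); rewrite -eq_a.
  by apply: eq_Zsum => // F _; rewrite setUCA.
rewrite eq_b0 eq_b1 eq_b2 eq_a -subr_ge0.
(* Every [F] counted by [a] is counted by [b], by [I'sub]. *)
have ab : a set0 <= b set0.
  by rewrite -eq_a -eq_b0; apply: Zsum_le => // F FS;
     rewrite I12 ?I'0 ?powersetE //; apply: I'sub.
have b_ge0 : 0 <= b set0 by rewrite -eq_b0 Zsum_ge0.
rewrite (_ : _ - _ = beta e1 * beta e2 * (b set0 * (b set0 - a set0))); last by ring.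
by rewrite !mulr_ge0 ?subr_ge0 //; apply: ltW.
Qed.

End Pairs.

Variables (e1 e2 : E).
Hypotheses (e1S : e1 \notin S) (e2S : e2 \notin S) (e12 : e1 != e2).
Hypothesis I1 : {in powerset S, forall F, I (e1 |: F) = I F}.
Hypothesis I2 : {in powerset S, forall F, I (e2 |: F) = I F}.
Hypothesis I12 : {in powerset S, forall F, I (e1 |: (e2 |: F)) = I' (e0 |: F)}.

Lemma nc_series :
  nc_system (e1 |: (e2 |: S)) I <-> nc_system (e0 |: S) I'.
Proof.
have I21 : {in powerset S, forall F, I (e2 |: (e1 |: F)) = I' (e0 |: F)}.
  by move=> F FS; rewrite setUCA I12.
have e21 : e2 != e1 by rewrite eq_sym.
split=> nc.
  move=> beta' bpos.
  have b0 : 0 < beta' e0 by rewrite bpos ?setU11.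
  (* A solution of [b1 * b2 = beta' e0 * (1 + b1 + b2)]. *)
  pose b1 := 1 + beta' e0; pose b2 := beta' e0 * (2 + beta' e0).
  pose beta e := if e == e1 then b1 else if e == e2 then b2 else beta' e.
  have be1 : beta e1 = b1 by rewrite /beta eqxx.
  have be2 : beta e2 = b2 by rewrite /beta eqxx (negPf e21).
  have eqb : {in S, beta =1 beta'}.
    by move=> e eS; rewrite /beta ![e == _]eq_sym !(negPf (setU2_ne _ eS)).
  have b1_gt0 : 0 < beta e1 by rewrite be1 addr_gt0.
  have b2_gt0 : 0 < beta e2 by rewrite be2 mulr_gt0 ?addr_gt0.
  have bk : beta e1 * beta e2 = beta' e0 * (1 + beta e1 + beta e2).
    by rewrite be1 be2 /b1 /b2; ring.
  have bpos' : {in e1 |: (e2 |: S), forall e, 0 < beta e}.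
    move=> e; rewrite !inE => /or3P[/eqP->|/eqP->|eS] //.
    by rewrite eqb // bpos // setU1r.
  have main y : y \in S -> nc_pair (e0 |: S) I' beta' e0 y.
    move=> yS; apply/(nc_pair_series_in e1S e2S e12 I1 I2 I12 eqb) => //.
    by apply: nc; rewrite ?(setU2_ne _ yS) // !inE ?eqxx ?yS ?orbT.
  move=> x y /setU1P[->|xS] /setU1P[->|yS]; rewrite ?eqxx // => ne.
  - exact: main.
  - by apply: nc_pairC; apply: main.
  - apply/(nc_pair_series_out e1S e2S e12 I1 I2 I12 eqb) => //.
    by apply: nc; rewrite // !inE ?xS ?yS !orbT.
move=> beta bpos.
have b1 : 0 < beta e1 by rewrite bpos ?setU11.
have b2 : 0 < beta e2 by rewrite bpos // !inE eqxx orbT.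
have bS : {in S, forall e, 0 < beta e}.
  by move=> e eS; rewrite bpos // !inE eS !orbT.
have s_gt0 : 0 < 1 + beta e1 + beta e2 by rewrite !addr_gt0.
(* The value forced by the series relation. The name [e0] may be that of [e1] or [e2], so [beta'] is
   only claimed to agree with [beta] on [S]. *)
pose k := beta e1 * beta e2 / (1 + beta e1 + beta e2).
pose beta' e := if e == e0 then k else beta e.
have be0 : beta' e0 = k by rewrite /beta' eqxx.
have b0 : 0 < beta' e0 by rewrite be0 divr_gt0 ?mulr_gt0.
have bk : beta e1 * beta e2 = beta' e0 * (1 + beta e1 + beta e2).
  by rewrite be0 divfK ?gt_eqF.
have bk' : beta e2 * beta e1 = beta' e0 * (1 + beta e2 + beta e1).
  by rewrite mulrC bk; ring.
have eqb : {in S, beta =1 beta'}.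
  by move=> e eS; rewrite /beta' [e == _]eq_sym (negPf (setU2_ne e0S eS)).
have bpos' : {in e0 |: S, forall e, 0 < beta' e}.
  by move=> e /setU1P[->|eS] //; rewrite -eqb // bS.
have main1 y : y \in S -> nc_pair (e1 |: (e2 |: S)) I beta e1 y.
  move=> yS; apply/(nc_pair_series_in e1S e2S e12 I1 I2 I12 eqb) => //.
  by apply: nc; rewrite ?(setU2_ne _ yS) // !inE ?eqxx ?yS ?orbT.
have main2 y : y \in S -> nc_pair (e1 |: (e2 |: S)) I beta e2 y.
  (* The situation is symmetric in [e1] and [e2], so the result for [e1] applies after exchanging
     them. *)
  move=> yS; rewrite setUCA.
  apply/(nc_pair_series_in e2S e1S e21 I2 I1 I21 eqb) => //.
  by apply: nc; rewrite ?(setU2_ne _ yS) // !inE ?eqxx ?yS ?orbT.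
have main12 : nc_pair (e1 |: (e2 |: S)) I beta e1 e2.
  exact: (nc_pair_series12 e1S e2S e12 I1 I2 I12 eqb).
move=> x y; rewrite !inE => /or3P[/eqP->|/eqP->|xS] /or3P[/eqP->|/eqP->|yS];
  rewrite ?eqxx // => ne; try by [apply: main1|apply: main2];
  try by apply: nc_pairC; by [apply: main1|apply: main2|].
apply/(nc_pair_series_out e1S e2S e12 I1 I2 I12 eqb) => //.
by apply: nc; rewrite // !inE ?xS ?yS !orbT.
Qed.

End Series.

(** * Two parallel elements *)

Section Parallel.
Variables (S : {set E}) (I : pred {set E}) (e1 e2 : E).
Hypotheses (e1S : e1 \notin S) (e2S : e2 \notin S) (e12 : e1 != e2).
(** The merged element keeps the name [e1], with a new parameter, so that the same family [I] serves
    before and after merging. *)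
Hypothesis I2 : {in powerset S, forall F, I (e2 |: F) = I (e1 |: F)}.
Hypothesis I12 : {in powerset S, forall F, I (e1 |: (e2 |: F)) = false}.

Lemma Zsum_pred0 J beta X :
  {in powerset S, forall F, J F = false} -> Zsum S J beta X = 0.
Proof.
move=> J0; rewrite /Zsum big1 // => F /and3P[FS JF _].
by rewrite J0 ?powersetE in JF.
Qed.

Section Pairs.
Variables beta beta' : E -> R.
Hypothesis eqb : {in S, beta =1 beta'}.
Hypotheses (b0 : 0 < beta' e1) (b1 : 0 < beta e1) (b2 : 0 < beta e2).

Let b X := Zsum S I beta' X.
Let a X := Zsum S (fun F => I (e1 |: F)) beta' X.

Let eq_b X : Zsum S I beta X = b X.
Proof. exact: eq_Zsum. Qed.
Let eq_a1 X : Zsum S (fun F => I (e1 |: F)) beta X = a X.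
Proof. exact: eq_Zsum. Qed.
Let eq_a2 X : Zsum S (fun F => I (e2 |: F)) beta X = a X.
Proof. by apply: eq_Zsum => // F FS; rewrite I2. Qed.
Let eq_0 X : Zsum S (fun F => I (e1 |: (e2 |: F))) beta X = 0.
Proof. exact: Zsum_pred0. Qed.

(** Contracting [e1] gives [a], deleting it gives [b + beta e2 * a]; the products [a set0 * a
    [set y]] cancel. *)
Lemma nc_pair_parallel_in y : y \in S ->
  nc_pair (e1 |: (e2 |: S)) I beta e1 y <-> nc_pair (e1 |: S) I beta' e1 y.
Proof.
move=> yS; rewrite (nc_pair_in _ e1S) // -/(a _) -/(b _) -/(a _) -/(b _).
rewrite nc_pair_in2 // !eq_b !eq_a1 !eq_a2 !eq_0.
rewrite -subr_ge0 (_ : _ - _ = a set0 * b [set y] - a [set y] * b set0).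
  by rewrite subr_ge0.
by ring.
Qed.

Lemma nc_pair_parallel_in' y : y \in S ->
  nc_pair (e1 |: (e2 |: S)) I beta e2 y <-> nc_pair (e1 |: S) I beta' e1 y.
Proof.
move=> yS; rewrite (nc_pair_in _ e1S) // -/(a _) -/(b _) -/(a _) -/(b _).
have eq_0' X : Zsum S (fun F => I (e2 |: (e1 |: F))) beta X = 0.
  by apply: Zsum_pred0 => F FS; rewrite setUCA I12.
rewrite setUCA nc_pair_in2 1?eq_sym // !eq_b !eq_a1 !eq_a2 !eq_0'.
rewrite -subr_ge0 (_ : _ - _ = a set0 * b [set y] - a [set y] * b set0).
  by rewrite subr_ge0.
by ring.
Qed.

(** Both sums equal [b + (beta e1 + beta e2) * a], hence the scaling factor 1. *)
Lemma nc_pair_parallel_out x y : beta e1 + beta e2 = beta' e1 ->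
  x \in S -> y \in S ->
  nc_pair (e1 |: (e2 |: S)) I beta x y <-> nc_pair (e1 |: S) I beta' x y.
Proof.
move=> bk xS yS.
apply: (@nc_pair_scale S I I e1 e1 e2 e1S 1 (beta' e1) b a) => //.
move=> X XS; rewrite Zsum_out2 // eq_b eq_a1 eq_a2 eq_0 -bk.
by ring.
Qed.

End Pairs.

Lemma nc_pair_parallel12 beta : {in e1 |: (e2 |: S), forall e, 0 < beta e} ->
  nc_pair (e1 |: (e2 |: S)) I beta e1 e2.
Proof.
move=> bpos; rewrite /nc_pair Zsum_in2 // Zsum_pred0 // !mulr0 mul0r.
by rewrite mulr_ge0 ?Zsum_ge0.
Qed.

Lemma nc_parallel : nc_system (e1 |: (e2 |: S)) I <-> nc_system (e1 |: S) I.
Proof.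
have e21 : e2 != e1 by rewrite eq_sym.
split=> nc.
  move=> beta' bpos.
  have b0 : 0 < beta' e1 by rewrite bpos ?setU11.
  (* Any splitting of [beta' e1] into two positive parts would do. *)
  pose beta e := if e \in [set e1; e2] then beta' e1 / 2 else beta' e.
  have be1 : beta e1 = beta' e1 / 2 by rewrite /beta set21.
  have be2 : beta e2 = beta' e1 / 2 by rewrite /beta set22.
  have eqb : {in S, beta =1 beta'}.
    move=> e eS; rewrite /beta !inE ![e == _]eq_sym.
    by rewrite !(negPf (setU2_ne _ eS)).
  have b1_gt0 : 0 < beta e1 by rewrite be1 divr_gt0.
  have b2_gt0 : 0 < beta e2 by rewrite be2 divr_gt0.
  have bk : beta e1 + beta e2 = beta' e1 by rewrite be1 be2; lra.
  have bpos' : {in e1 |: (e2 |: S), forall e, 0 < beta e}.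
    move=> e; rewrite !inE => /or3P[/eqP->|/eqP->|eS] //.
    by rewrite eqb // bpos // setU1r.
  have main y : y \in S -> nc_pair (e1 |: S) I beta' e1 y.
    move=> yS; apply/(nc_pair_parallel_in eqb) => //.
    by apply: nc; rewrite ?(setU2_ne _ yS) // !inE ?eqxx ?yS ?orbT.
  move=> x y /setU1P[->|xS] /setU1P[->|yS]; rewrite ?eqxx // => ne.
  - exact: main.
  - by apply: nc_pairC; apply: main.
  - apply/(nc_pair_parallel_out eqb) => //.
    by apply: nc; rewrite // !inE ?xS ?yS !orbT.
move=> beta bpos.
have b1 : 0 < beta e1 by rewrite bpos ?setU11.
have b2 : 0 < beta e2 by rewrite bpos // !inE eqxx orbT.
have bS : {in S, forall e, 0 < beta e}.
  by move=> e eS; rewrite bpos // !inE eS !orbT.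
pose beta' e := if e == e1 then beta e1 + beta e2 else beta e.
have bk : beta e1 + beta e2 = beta' e1 by rewrite /beta' eqxx.
have b0 : 0 < beta' e1 by rewrite -bk addr_gt0.
have eqb : {in S, beta =1 beta'}.
  by move=> e eS; rewrite /beta' [e == _]eq_sym (negPf (setU2_ne e1S eS)).
have bpos' : {in e1 |: S, forall e, 0 < beta' e}.
  by move=> e /setU1P[->|eS] //; rewrite -eqb // bS.
have main1 y : y \in S -> nc_pair (e1 |: (e2 |: S)) I beta e1 y.
  move=> yS; apply/(nc_pair_parallel_in eqb) => //.
  by apply: nc; rewrite ?(setU2_ne _ yS) // !inE ?eqxx ?yS ?orbT.
have main2 y : y \in S -> nc_pair (e1 |: (e2 |: S)) I beta e2 y.
  move=> yS; apply/(nc_pair_parallel_in' eqb) => //.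
  by apply: nc; rewrite ?(setU2_ne _ yS) // !inE ?eqxx ?yS ?orbT.
have main12 := nc_pair_parallel12 bpos.
move=> x y; rewrite !inE => /or3P[/eqP->|/eqP->|xS] /or3P[/eqP->|/eqP->|yS];
  rewrite ?eqxx // => ne; try by [apply: main1|apply: main2];
  try by apply: nc_pairC; by [apply: main1|apply: main2|].
apply/(nc_pair_parallel_out eqb) => //.
by apply: nc; rewrite // !inE ?xS ?yS !orbT.
Qed.

End Parallel.

End IndependenceSystems.

(** * Renaming the elements *)

Section Relabelling.
Variables (R : realType) (E E' : finType) (h : E -> E') (S : {set E}).
Variables (I : pred {set E}) (I' : pred {set E'}).
Hypothesis h_inj : {in S &, injective h}.
Hypothesis I'h : {in powerset S, forall F : {set E}, I' (h @: F) = I F}.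

Lemma preimset_imset (F : {set E}) : F \subset S -> S :&: h @^-1: (h @: F) = F.
Proof.
move=> FS; apply/setP=> e; rewrite !inE; apply/andP/idP => [[eS]|eF].
  by case/imsetP=> e' e'F /h_inj-> //; apply: (subsetP FS).
by rewrite (subsetP FS) // imset_f.
Qed.

Lemma imset_preimset (F' : {set E'}) :
  F' \subset h @: S -> h @: (S :&: h @^-1: F') = F'.
Proof.
move=> F'S; apply/setP=> x; apply/imsetP/idP => [[e]|xF'].
  by rewrite !inE => /andP[_ ?] ->.
have /imsetP[e eS ex] := subsetP F'S x xF'.
by exists e; rewrite // !inE eS -ex.
Qed.

Lemma Zsum_imset (beta : E' -> R) (X : {set E}) : X \subset S ->
  Zsum (h @: S) I' beta (h @: X) = Zsum S I (beta \o h) X.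
Proof.
move=> XS; rewrite /Zsum.
rewrite (reindex_onto (fun F : {set E} => h @: F)
  (fun F' => S :&: h @^-1: F')) /=; last first.
  by move=> F' /and3P[/imset_preimset].
apply: eq_big => [F|F].
  case FS: (F \subset S); last first.
    apply: contraFF FS => /andP[_ /eqP<-]; exact: subsetIl.
  rewrite preimset_imset // eqxx andbT imsetS // I'h ?powersetE //=.
  congr (_ && _); apply/idP/idP => [hXF|]; last exact: imsetS.
  rewrite -(preimset_imset XS) -(preimset_imset FS) setIS //.
  exact: preimsetS.
case/andP=> _ /eqP eF.
have FS : F \subset S by rewrite -eF subsetIl.
by rewrite big_imset //; apply: sub_in2 h_inj; apply/subsetP.
Qed.

(** Meant for [h] the endpoint map of a graph without loops or parallel edges, whose edges thereby
    become the pairs they join. *)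
Lemma nc_system_imset : nc_system R S I <-> nc_system R (h @: S) I'.
Proof.
split=> nc beta bpos.
  move=> _ _ /imsetP[e1 e1S ->] /imsetP[e2 e2S ->] ne.
  rewrite /nc_pair -!imset_set1 -imsetU -(imset0 h).
  rewrite !Zsum_imset ?sub0set ?subUset ?sub1set ?e1S //.
  apply: nc => // [e eS|]; first by rewrite /= bpos // imset_f.
  by apply: contra_neq ne => ->.
move=> e1 e2 e1S e2S ne.
(* This is [beta] composed with the inverse of [h] on [S]; the value 1 off the image is a
   placeholder. *)
pose beta' x := if [pick e in S | h e == x] is Some e then beta e else 1.
have eqb : {in S, beta =1 beta' \o h}.
  move=> e eS; rewrite /beta' /=; case: pickP => [e' /andP[e'S /eqP/h_inj->]//|].
  by move/(_ e); rewrite /= eS eqxx.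
have eqZ (X : {set E}) : X \subset S ->
    Zsum S I beta X =
    Zsum (h @: S) I' beta' (h @: X).
  by move=> XS; rewrite Zsum_imset //; apply: eq_Zsum.
rewrite /nc_pair !eqZ ?sub0set ?subUset ?sub1set ?e1S //.
rewrite imset0 imsetU !imset_set1; apply: nc; rewrite ?imset_f //.
  by move=> _ /imsetP[e eS ->]; rewrite -[beta' _]eqb // bpos.
by apply: contra_neq ne => /h_inj->.
Qed.

End Relabelling.

(** * Acyclic edge sets *)

(** [A] is an invariant of the walk from [x]: a step needs a counterpart only if it starts in
    [A]. *)
Lemma connect_morph (T T' : finType) (r : rel T) (r' : rel T') (h : T -> T')
    (A : {pred T}) x y :
  (forall a b, a \in A -> r a b -> b \in A /\ connect r' (h a) (h b)) ->
  x \in A -> connect r x y -> connect r' (h x) (h y).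
Proof.
move=> hr + /connectP[p + ->]; elim: p x => //= z p IHp x xA /andP[rxz pth].
have [zA cxz] := hr _ _ xA rxz.
exact: connect_trans cxz (IHp _ zA pth).
Qed.

(** The case [x = y] is allowed, so that loops and ordinary edges are treated alike. *)
Lemma card_le2_set2 (T : finType) (A : {set T}) :
  (0 < #|A| <= 2)%N -> exists x y, A = [set x; y].
Proof.
case/andP=> A0; rewrite leq_eqVlt => /orP[/cards2P[x [y [_ ->]]]|]; first by exists x, y.
rewrite ltnS => A1; have /cards1P[x ->] : #|A| == 1%N by rewrite eqn_leq A1.
by exists x, x; rewrite setUid.
Qed.

Section EdgeSets.
Variables V E : finType.
Implicit Types (F S : {set E}) (x y u v : V) (e : E) (en : E -> {set V}).

Definition edge_rel en F : rel V :=
  fun x y => [exists e in F, en e == [set x; y]].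

(** Acyclicity in the form that all edges of [F] are bridges of [F], which avoids cycles as lists.
    Loops are excluded because [connect] is reflexive. *)
Definition acyclic en F : bool :=
  [forall e in F, forall x, forall y,
     (en e == [set x; y]) ==> ~~ connect (edge_rel en (F :\ e)) x y].

Lemma edge_relP en F x y :
  reflect (exists2 e, e \in F & en e = [set x; y]) (edge_rel en F x y).
Proof.
apply: (iffP existsP) => [[e /andP[eF /eqP en_e]]|[e eF en_e]]; exists e => //.
by rewrite eF en_e eqxx.
Qed.

Lemma acyclicP en F :
  reflect (forall e x y, e \in F -> en e = [set x; y] ->
             ~~ connect (edge_rel en (F :\ e)) x y) (acyclic en F).
Proof.
apply: (iffP forallP) => [ac e x y eF en_e|ac e].
  have := ac e; rewrite eF /= => /forallP/(_ x)/forallP/(_ y).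
  by rewrite en_e eqxx.
apply/implyP=> eF; apply/forallP=> x; apply/forallP=> y.
by apply/implyP=> /eqP; apply: ac.
Qed.

Lemma edge_rel_sym en F : symmetric (edge_rel en F).
Proof.
by move=> x y; apply/edge_relP/edge_relP => -[e eF en_e]; exists e; rewrite // setUC.
Qed.

Lemma edge_connectC en F x y :
  connect (edge_rel en F) x y = connect (edge_rel en F) y x.
Proof. exact/sym_connect_sym/edge_rel_sym. Qed.

Lemma edge_connectS en F S x y : F \subset S ->
  connect (edge_rel en F) x y -> connect (edge_rel en S) x y.
Proof.
move=> FS; apply: connect_sub => a b /edge_relP[e eF en_e].
by apply/connect1/edge_relP; exists e; rewrite // (subsetP FS).
Qed.

Lemma connect_edge en F e x y : e \in F -> en e = [set x; y] ->
  connect (edge_rel en F) x y.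
Proof. by move=> eF en_e; apply/connect1/edge_relP; exists e. Qed.

Lemma set2_eq (x y a b : V) : [set x; y] = [set a; b] ->
  (x = a /\ y = b) \/ (x = b /\ y = a).
Proof.
move=> eq.
have : (x \in [set a; b]) && (y \in [set a; b]) by rewrite -eq set21 set22.
have : (a \in [set x; y]) && (b \in [set x; y]) by rewrite eq set21 set22.
rewrite !inE => /andP[/orP[]/eqP-> /orP[]/eqP->]; rewrite ?orbb ?eqxx ?orbT.
- by move=> /eqP->; left.
- by left.
- by right.
- by rewrite andbT => /eqP->; left.
Qed.

Lemma eq_edge_rel en en' F : {in F, en =1 en'} -> edge_rel en F =2 edge_rel en' F.
Proof.
move=> eq x y; apply/edge_relP/edge_relP => -[e eF en_e]; exists e => //.
  by rewrite -eq.
by rewrite eq.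
Qed.

Lemma eq_acyclic en en' F : {in F, en =1 en'} -> acyclic en F = acyclic en' F.
Proof.
move=> eq; have eqD e : edge_rel en (F :\ e) =2 edge_rel en' (F :\ e).
  by apply: eq_edge_rel => f /setD1P[_]; apply: eq.
apply/acyclicP/acyclicP => ac e x y eF en_e.
  by rewrite -(eq_connect (eqD e)) ac ?eq.
by rewrite (eq_connect (eqD e)) ac -?eq.
Qed.

Lemma acyclic0 en : acyclic en set0.
Proof. by apply/acyclicP=> e x y; rewrite inE. Qed.

Lemma acyclicS en F S : F \subset S -> acyclic en S -> acyclic en F.
Proof.
move=> FS /acyclicP ac; apply/acyclicP=> e x y eF en_e.
apply: contra (ac e x y (subsetP FS e eF) en_e).
exact/edge_connectS/setSD.
Qed.

Lemma acyclic_loop en F e : e \in F -> #|en e| = 1%N -> acyclic en F = false.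
Proof.
move=> eF /eqP/cards1P[x en_e]; apply/acyclicP=> /(_ e x x eF).
by rewrite setUid connect0 => /(_ en_e).
Qed.

Lemma acyclic_parallel en F e e' : (0 < #|en e| <= 2)%N ->
  e \in F -> e' \in F -> e != e' -> en e = en e' -> acyclic en F = false.
Proof.
move=> crd eF e'F ne eq; apply/acyclicP=> ac.
have [x [y en_e]] := card_le2_set2 crd.
have := ac e x y eF en_e.
by rewrite (@connect_edge _ _ e') // ?inE ?e'F 1?eq_sym ?ne -?eq.
Qed.

(** * Vertices of degree one and two *)

Section Series.
Variables (en : E -> {set V}) (u : V) (F : {set E}).
Hypothesis uF : {in F, forall e, u \notin en e}.

(** Moving [u] to [v] collapses [e] and fixes every edge of [D], none of which meets [u]. *)
Lemma leaf_retract (D : {set E}) e v x y :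
  D \subset F -> v != u -> en e = [set u; v] ->
  connect (edge_rel en (e |: D)) x y ->
  connect (edge_rel en D) (if x == u then v else x) (if y == u then v else y).
Proof.
move=> DF vu en_e.
apply: (connect_morph (h := fun x => if x == u then v else x) (A := predT)) => //.
move=> a b _ /edge_relP[f /setU1P[->|fD] en_f]; split=> //.
  rewrite en_e in en_f.
  by case/set2_eq: en_f => -[<- <-]; rewrite eqxx (negPf vu) connect0.
have := uF (subsetP DF f fD); rewrite en_f !inE negb_or ![u == _]eq_sym.
by case/andP=> /negPf-> /negPf->; apply: connect_edge en_f.
Qed.

Lemma ends_neq f x y : f \in F -> en f = [set x; y] ->
  (x == u) = false /\ (y == u) = false.
Proof.
move=> fF en_f; have := uF fF; rewrite en_f !inE negb_or ![u == _]eq_sym.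
by case/andP=> /negPf-> /negPf->.
Qed.

Lemma setU1D1 e f (D : {set E}) : e != f -> (e |: D) :\ f = e |: (D :\ f).
Proof.
by move=> ef; rewrite setDUl; congr (_ :|: _); rewrite setD1_notin // inE eq_sym.
Qed.

(** [u] is isolated in [F], so [e] is a bridge; by the retraction, [e] creates no new connection
    between vertices other than [u]. *)
Lemma acyclic_leaf e v : v != u -> en e = [set u; v] ->
  acyclic en (e |: F) = acyclic en F.
Proof.
move=> vu en_e; apply/idP/idP => [|/acyclicP ac]; first exact/acyclicS/subsetU1.
have eF : e \notin F by apply/negP => /uF; rewrite en_e set21.
apply/acyclicP=> f x y /setU1P[->|fF] en_f.
  rewrite setU1K //; rewrite en_e in en_f.
  suff : ~~ connect (edge_rel en F) u v.
    by case/set2_eq: en_f => -[<- <-] //; rewrite edge_connectC.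
  (* A walk leaving [u] would start with an edge of [F] at [u]. *)
  apply/connectP => -[[|z p] /=]; first by move=> _ /eqP; rewrite (negPf vu).
  by case/andP=> /edge_relP[f' f'F /(ends_neq f'F)]; rewrite eqxx => -[].
have ef : e != f by apply: contraNneq eF => ->.
have [xu yu] := ends_neq fF en_f.
rewrite setU1D1 //; apply: contra (ac f x y fF en_f).
by move/(leaf_retract (subD1set _ _) vu en_e); rewrite xu yu.
Qed.

(** The vertex [u] subdivides [e0] into [e1] and [e2]. Walks are carried one way by replacing [e0]
    with the path through [u], the other way by contracting one of the two edges. *)
Lemma acyclic_series en' e0 e1 e2 v1 v2 :
  v1 != u -> v2 != u -> e1 != e2 -> e0 \notin F ->
  en e1 = [set u; v1] -> en e2 = [set u; v2] -> en' e0 = [set v1; v2] ->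
  {in F, en' =1 en} ->
  acyclic en (e1 |: (e2 |: F)) = acyclic en' (e0 |: F).
Proof.
move=> v1u v2u e12 e0F en1 en2 en0 eqF.
have e1F : e1 \notin F by apply/negP => /uF; rewrite en1 set21.
have e2F : e2 \notin F by apply/negP => /uF; rewrite en2 set21.
have e1F2 : e1 \notin e2 |: F by rewrite !inE negb_or e12.
have en'F (D : {set E}) x y : D \subset F ->
    connect (edge_rel en' D) x y = connect (edge_rel en D) x y.
  by move=> DF; apply: eq_connect; apply: eq_edge_rel => e /(subsetP DF)/eqF.
have D0 f : f \in F -> (e0 |: F) :\ f = e0 |: (F :\ f).
  by move=> fF; rewrite setU1D1 //; apply: contraNneq e0F => ->.
have D1 f : f \in F -> (e1 |: (e2 |: F)) :\ f = e1 |: (e2 |: (F :\ f)).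
  move=> fF; rewrite !setU1D1 //; first by apply: contraNneq e2F => ->.
  by apply: contraNneq e1F => ->.
apply/acyclicP/acyclicP => ac.
  move=> f x y /setU1P[->|fF] en_f.
    rewrite setU1K // en'F //; rewrite en0 in en_f.
    suff : ~~ connect (edge_rel en F) v1 v2.
      by case/set2_eq: en_f => -[<- <-] //; rewrite edge_connectC.
    have := ac e1 u v1; rewrite setU11 en1 setU1K // => /(_ isT erefl).
    (* Together with [e2], a walk in [F] between [v1] and [v2] would join the ends of [e1]. *)
    apply: contra => c12; apply: connect_trans (_ : connect _ v2 v1).
      by apply: connect_edge en2; rewrite setU11.
    by rewrite edge_connectC; apply: edge_connectS c12; apply: subsetU1.
  rewrite D0 //; have := ac f x y; rewrite !in_setU1 fF !orbT -eqF //.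
  move=> /(_ isT en_f); rewrite D1 //; apply: contra; apply: connect_sub => a b.
  (* A passage through [e0] becomes the path [v1], [u], [v2]. *)
  case/edge_relP=> g /setU1P[->|gF] en_g.
    have c12 : connect (edge_rel en (e1 |: (e2 |: F :\ f))) v1 v2.
      apply: (@connect_trans _ _ u).
        by rewrite edge_connectC; apply: connect_edge en1; rewrite setU11.
      by apply: connect_edge en2; rewrite !inE eqxx orbT.
    by rewrite en0 in en_g; case/set2_eq: en_g => -[<- <-] //; rewrite edge_connectC.
  have [gF' _] := setD1P gF.
  apply: connect_edge (_ : en g = _); first by rewrite !in_setU1 gF !orbT.
  by rewrite -eqF //; case/setD1P: gF.
have ac0 : ~~ connect (edge_rel en F) v1 v2.
  by have := ac e0 v1 v2; rewrite setU11 setU1K // en'F //; apply.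
move=> f x y /setU1P[->|/setU1P[->|fF]] en_f.
- rewrite setU1K //; rewrite en1 in en_f.
  suff : ~~ connect (edge_rel en (e2 |: F)) u v1.
    by case/set2_eq: en_f => -[<- <-] //; rewrite edge_connectC.
  (* Retracting [u] to [v2] turns a walk from [u] to [v1] into one from [v2] to [v1] in [F]. *)
  apply: contra ac0 => /(leaf_retract (subxx _) v2u en2).
  by rewrite eqxx (negPf v1u) edge_connectC.
- rewrite setUCA setU1K; last by rewrite !inE negb_or eq_sym e12.
  rewrite en2 in en_f.
  suff : ~~ connect (edge_rel en (e1 |: F)) u v2.
    by case/set2_eq: en_f => -[<- <-] //; rewrite edge_connectC.
  apply: contra ac0 => /(leaf_retract (subxx _) v1u en1).
  by rewrite eqxx (negPf v2u).
have [xu yu] := ends_neq fF en_f.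
rewrite D1 //; have := ac f x y; rewrite setU1r // eqF // D0 // => /(_ isT en_f).
(* Moving [u] to [v1] contracts [e1] and turns [e2] into [e0]. *)
pose r x := if x == u then v1 else x.
apply: contra => /(connect_morph (h := r) (A := predT)
  (r' := edge_rel en' (e0 |: F :\ f))).
rewrite /r xu yu; apply=> // a b _ /edge_relP[g gF en_g]; split=> //.
case/setU1P: gF en_g => [->|/setU1P[->|gF]] en_g.
- rewrite en1 in en_g.
  by case/set2_eq: en_g => -[<- <-]; rewrite eqxx (negPf v1u) connect0.
- have c0 : connect (edge_rel en' (e0 |: F :\ f)) v1 v2.
    by apply: connect_edge en0; rewrite setU11.
  rewrite en2 in en_g.
  by case/set2_eq: en_g => -[<- <-]; rewrite eqxx (negPf v2u) // edge_connectC.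
have /setD1P[_ gF'] := gF; have [-> ->] := ends_neq gF' en_g.
by rewrite -eqF // in en_g; apply: connect_edge en_g; rewrite setU1r.
Qed.

End Series.

(** A walk can be shortened to pass through [e] at most once, in one of the two directions. *)
Lemma connect_bridge en (D : {set E}) e a b x y : en e = [set a; b] ->
  connect (edge_rel en (e |: D)) x y ->
  [\/ connect (edge_rel en D) x y,
      connect (edge_rel en D) x a /\ connect (edge_rel en D) b y |
      connect (edge_rel en D) x b /\ connect (edge_rel en D) a y].
Proof.
move=> en_e /connectP[p + ->]; elim: p x => [|z p IHp] x /=; first by constructor 1.
case/andP=> /edge_relP[f /setU1P[->|fD] en_f] /IHp; set y' := last z p.
  rewrite en_e in en_f; case/set2_eq: en_f => -[<- <-].
    by case=> [c|[_ c]|[_ c]]; [constructor 2|constructor 2|constructor 1].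
  by case=> [c|[_ c]|[_ c]]; [constructor 3|constructor 1|constructor 3].
have cxz := connect_edge fD en_f.
case=> [c|[c1 c2]|[c1 c2]].
- by constructor 1; apply: connect_trans c.
- by constructor 2; split=> //; apply: connect_trans c1.
- by constructor 3; split=> //; apply: connect_trans c1.
Qed.

(** * Bridges, components and loops as separators *)

Section Bridges.
Variables (en : E -> {set V}) (S P : {set E}).
Hypothesis en_card : {in S, forall e, 0 < #|en e| <= 2}%N.
Hypothesis bridgeP : forall e x y, e \in P -> en e = [set x; y] ->
  ~~ connect (edge_rel en (S :\ e)) x y.

(* If [e] were needed to join the ends of [f], then [f] would join the ends of
   [e] in [S :\ e]. *)
Lemma acyclicD1_bridge F e : F \subset S -> e \in P ->
  acyclic en (F :\ e) = acyclic en F.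
Proof.
move=> FS eP; apply/idP/idP => [/acyclicP ac|]; last exact/acyclicS/subD1set.
apply/acyclicP=> f x y fF en_f; case: (eqVneq f e) => [fe|fe].
  rewrite fe in en_f *; apply: contra (bridgeP eP en_f).
  exact/edge_connectS/setSD.
have acf : ~~ connect (edge_rel en (F :\ e :\ f)) x y.
  by apply: ac; rewrite // !inE fe.
case: (boolP (e \in F)) => eF; last by move: acf; rewrite [F :\ e]setD1_notin.
have DF : F :\ f = e |: (F :\ e :\ f).
  by rewrite -setU1D1 1?eq_sym // setD1K.
have [a [b en_e]] := card_le2_set2 (en_card (subsetP FS e eF)).
have := bridgeP eP en_e; rewrite DF; apply: contra => /(connect_bridge en_e).
have sub z w : connect (edge_rel en (F :\ e :\ f)) z w ->
    connect (edge_rel en (S :\ e)) z w.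
  by apply/edge_connectS/(subset_trans (subD1set _ _))/setSD.
have cxy : connect (edge_rel en (S :\ e)) x y.
  by apply: connect_edge en_f; rewrite !inE fe (subsetP FS).
case=> [c|[/sub cxa /sub cby]|[/sub cxb /sub cay]].
- by rewrite c in acf.
- rewrite edge_connectC in cxa; apply: connect_trans cxa _.
  by apply: connect_trans cxy _; rewrite edge_connectC.
- rewrite edge_connectC; rewrite edge_connectC in cxb; apply: connect_trans cxb _.
  by apply: connect_trans cxy _; rewrite edge_connectC.
Qed.

Lemma acyclicD_bridges F : F \subset S -> acyclic en (F :\: P) = acyclic en F.
Proof.
have [n] := ubnP #|F :&: P|; elim: n F => [F|n IHn F ltn FS].
  by rewrite ltn0 => /notF[].
have [FP|[e eFP]] := set_0Vmem (F :&: P).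
  by congr (acyclic _ _); apply/setDidPl; rewrite -setI_eq0 FP.
have /setIP[eF eP] := eFP.
rewrite -(acyclicD1_bridge FS eP) -(IHn (F :\ e)).
- by rewrite setDDl (setUidPr _) // sub1set.
- by rewrite setIDAC -ltnS (leq_trans _ ltn) // ltnS [X in (_ < X)%N](cardsD1 e) eFP.
- exact: subset_trans (subD1set _ _) FS.
Qed.

End Bridges.

(** Discarding bridges does not affect acyclicity; in particular a set consisting of bridges is
    acyclic. *)
Lemma separator_bridges en S (P : {set E}) :
  {in S, forall e, 0 < #|en e| <= 2}%N ->
  (forall e x y, e \in P -> en e = [set x; y] ->
     ~~ connect (edge_rel en (S :\ e)) x y) ->
  separator S (acyclic en) P.
Proof.
move=> crd bridge F FS; rewrite -(acyclicD_bridges crd bridge FS).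
rewrite -(acyclicD_bridges crd bridge (subset_trans (subsetIl F P) FS)).
have -> : F :&: P :\: P = set0 by apply/eqP; rewrite setD_eq0 subsetIr.
by rewrite acyclic0.
Qed.

(** A walk that starts inside [C] uses only edges inside [C], and one that starts outside uses none
    of them. *)
Lemma separator_component en S (C : {set V}) :
  {in S, forall e, (en e \subset C) || [disjoint en e & C]} ->
  separator S (acyclic en) [set e | en e \subset C].
Proof.
move=> compC F FS; set A := [set e | _].
apply/idP/andP => [ac|[/acyclicP acI /acyclicP acD]].
  by rewrite (acyclicS (subsetIl F A)) ?(acyclicS (subsetDl F A)).
have mem_ends e x y : e \in F -> en e = [set x; y] ->
    (x \in C) = (e \in A) /\ (y \in C) = (e \in A).
  move=> eF en_e; have := compC e (subsetP FS e eF); rewrite inE.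
  case: (boolP (en e \subset C)) => [sub _|_ /= dis].
    by rewrite !(subsetP sub) ?en_e ?set21 ?set22.
  by rewrite !(disjointFr dis) ?en_e ?set21 ?set22.
apply/acyclicP=> e x y eF en_e; have [xC _] := mem_ends e x y eF en_e.
case: (boolP (e \in A)) => eA.
  have : e \in F :&: A by rewrite in_setI eF.
  move/acI/(_ en_e); apply: contra; apply: (connect_morph (h := id) (A := C)).
    move=> a b aC /edge_relP[f /setD1P[fe fF] en_f].
    have [fA bC] := mem_ends f a b fF en_f; rewrite bC -fA aC; split=> //.
    by apply: connect_edge en_f; rewrite in_setD1 fe in_setI fF -fA.
  by rewrite xC.
have : e \in F :\: A by rewrite in_setD eA.
move/acD/(_ en_e); apply: contra; apply: (connect_morph (h := id) (A := ~: C)).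
  move=> a b; rewrite !inE => aC /edge_relP[f /setD1P[fe fF] en_f].
  have [fA bC] := mem_ends f a b fF en_f; rewrite bC -fA aC; split=> //.
  by apply: connect_edge en_f; rewrite in_setD1 fe in_setD -fA aC.
by rewrite inE xC.
Qed.

(** If the loop is in [F], both sides are false; otherwise removing it changes nothing. *)
Lemma separator_loop en S e : #|en e| = 1%N -> separator S (acyclic en) [set e].
Proof.
move=> e1 F _; case: (boolP (e \in F)) => eF.
  by rewrite (acyclic_loop eF e1) (@acyclic_loop _ _ e) // !inE eF /=.
rewrite setD1_notin // (_ : F :&: [set e] = set0) ?acyclic0 //.
by apply/eqP; rewrite setIC setI_eq0 disjoints1.
Qed.

End EdgeSets.

(** Serves both to exchange two parallel edges and to name edges by their endpoints. *)
Lemma acyclic_imset (V E E' : finType) (en : E -> {set V}) (en' : E' -> {set V})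
    (h : E -> E') (F : {set E}) :
  {in F &, injective h} -> {in F, forall e, en' (h e) = en e} ->
  acyclic en' (h @: F) = acyclic en F.
Proof.
move=> h_inj en_h.
have rel_h e : e \in F ->
    edge_rel en' (h @: F :\ h e) =2 edge_rel en (F :\ e).
  move=> eF x y; apply/edge_relP/edge_relP => -[f].
    case/setD1P=> ne /imsetP[g gF fg]; rewrite fg en_h // => en_g.
    by exists g => //; rewrite !inE gF andbT; apply: contraNneq ne => ge; rewrite fg ge.
  case/setD1P=> ne fF en_f; exists (h f); rewrite ?en_h // !inE imset_f // andbT.
  by apply: contraNneq ne => /h_inj->.
apply/acyclicP/acyclicP => ac.
  move=> e x y eF en_e; rewrite -(eq_connect (rel_h e eF)).
  by apply: ac; rewrite ?imset_f ?en_h.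
move=> _ x y /imsetP[e eF ->]; rewrite en_h // => en_e.
by rewrite (eq_connect (rel_h e eF)) ac.
Qed.

(** * Forests of multigraphs *)

Section Forests.
Variables V E : finType.
Implicit Types (H : mgraph V E) (F S : {set E}) (en : E -> {set V}).

Let step en : rel (V * E) := fun p q => en p.2 == [set p.1; q.1].

(** One edge is chosen for each step. Recording that their ends lie on the path makes them distinct:
    the first contains [x], the later ones do not. The free [e] in the last clause is the edge that
    will close the cycle. *)
Lemma walk_of_path en F x p : path (edge_rel en F) x p -> uniq (x :: p) ->
  exists c : seq (V * E),
    [/\ rcons [seq q.1 | q <- c] (last x p) = x :: p,
        all (fun q => (q.2 \in F) && (en q.2 \subset [set z in x :: p])) c,
        uniq [seq q.2 | q <- c] &
        forall e, sorted (step en) (rcons c (last x p, e))].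
Proof.
elim: p x => [|z p IHp] x; first by exists [::].
rewrite [path _ _ _]/= => /andP[/edge_relP[f fF en_f] pth] /= /andP[xzp uzp].
have [c [c1 c2 c3 c4]] := IHp z pth uzp.
exists ((x, f) :: c); split=> /=.
- by rewrite c1.
- rewrite fF en_f /= subUset !sub1set !inE !eqxx orbT /=.
  apply: sub_all c2 => q /andP[-> sub]; apply: subset_trans sub _.
  by apply/subsetP=> w; rewrite !inE => ->; rewrite orbT.
- rewrite c3 andbT; apply/mapP=> -[q /(allP c2)/andP[_ sub] fq].
  have := subsetP sub x; rewrite -fq en_f set21 => /(_ isT).
  by rewrite in_set (negPf xzp).
move=> e; have := c4 e; case: c c1 {c2 c3 c4} => [|q c] /=.
  by case=> zl _; rewrite /step /= en_f zl eqxx.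
by case=> zq _ ->; rewrite /step /= en_f zq eqxx.
Qed.

(** If the ends of [e] stay joined without [e], a simple path between them, closed up by [e], is a
    cycle. *)
Lemma acyclic_of_forest H F : forest H F -> acyclic (ends H) F.
Proof.
case=> FH noc; apply/acyclicP=> e x y eF en_e; apply/negP.
rewrite edge_connectC => /connectP[p0 pth0 xl].
case/shortenP: pth0 xl => p pth unq _ xl {p0}.
have [c [c1 c2 c3 c4]] := walk_of_path pth unq.
pose c' := rcons c (x, e).
suff cyc : graph_cycle H c'.
  have /negP[] := noc c' cyc.
  rewrite all_rcons eF; apply: sub_all c2 => q /andP[/setD1P[_ ->]] //.
apply/and5P; split.
- by rewrite /c'; case: (c).
- by rewrite map_rcons /= xl c1.
- rewrite map_rcons rcons_uniq c3 andbT; apply/mapP=> -[q /(allP c2)/andP[]].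
  by move=> + _ /= eq; rewrite -eq !inE eqxx.
- rewrite all_rcons (subsetP FH e eF); apply: sub_all c2 => q /andP[/setD1P[_ qF] _].
  exact: (subsetP FH).
(* The empty list [c] is the case of a loop, [x = y]. *)
have := c4 e; rewrite -xl /c'; case: c c1 {c2 c3 c4 c'} => [|q c] /=.
  by case=> yx _ _; have xy : x = y by [rewrite xl yx]; rewrite /step en_e xy eqxx.
case=> qy _ st; rewrite rcons_path last_rcons /= st qy en_e eqxx.
by [].
Qed.

Lemma connect_of_walk en F q c r : path (step en) q (rcons c r) ->
  all (fun p => p.2 \in F) (q :: c) -> connect (edge_rel en F) q.1 r.1.
Proof.
elim: c q => [|z c IHc] q /=.
  by rewrite !andbT => /eqP en_q qF; apply: connect_edge en_q.
case/andP=> /eqP en_q pth /andP[qF zcF].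
exact: connect_trans (connect_edge qF en_q) (IHc z pth zcF).
Qed.

(** Following a cycle beyond its first edge joins the ends of that edge without using it. *)
Lemma forest_of_acyclic H F : F \subset edges H -> acyclic (ends H) F -> forest H F.
Proof.
move=> FH /acyclicP ac; split=> // -[|[x e] c] // /and5P[_ _ /= /andP[ec _] _ cyc].
apply/negP=> /andP[eF cF].
have cFe : all (fun p => p.2 \in F :\ e) c.
  apply/allP=> q qc; rewrite in_setD1 (allP cF) // andbT.
  by apply: contraNneq ec => <-; apply: map_f.
case: c cyc cFe {ec cF} => [|q c] /=.
  by rewrite andbT => /eqP en_e _; have := ac e x x eF en_e; rewrite connect0.
case/andP=> /eqP en_e pth cFe; have := ac e x q.1 eF en_e.
by rewrite edge_connectC (connect_of_walk pth cFe).
Qed.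

Lemma forestE H F : `[< forest H F >] = (F \subset edges H) && acyclic (ends H) F.
Proof.
apply/asboolP/andP => [f|[FH ac]]; last exact: forest_of_acyclic.
by split; [case: f | apply: acyclic_of_forest].
Qed.

(** * The Arboreal Gas under the graph operations *)

Variable R : realType.

Lemma prob_edgesE H (beta : E -> R) A :
  prob_edges H beta A = Zsum (edges H) (acyclic (ends H)) beta A /
                        Zsum (edges H) (acyclic (ends H)) beta set0.
Proof.
have -> : Zsum (edges H) (acyclic (ends H)) beta set0 = partition_function H beta.
  by apply: eq_bigl => F; rewrite sub0set andbT forestE.
rewrite /prob_edges /arboreal_gas -big_mkcondr /= mulr_suml.
by apply: eq_bigl => F; rewrite forestE andbC andbA.
Qed.

(** The partition function is positive, so the denominators can be cleared. *)
Lemma always_negative_correlationE H :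
  always_negative_correlation R H <-> nc_system R (edges H) (acyclic (ends H)).
Proof.
have pairE (beta : E -> R) e1 e2 : {in edges H, forall e, 0 < beta e} ->
    (prob_edges H beta [set e1; e2] <=
       prob_edges H beta [set e1] * prob_edges H beta [set e2]) <->
    nc_pair (edges H) (acyclic (ends H)) beta e1 e2.
  move=> bpos; have Z_gt0 := Zsum0_gt0 bpos (acyclic0 (ends H)).
  rewrite /nc_pair !prob_edgesE mulf_div ler_pdivlMr ?mulr_gt0 //.
  by rewrite mulrA divfK ?gt_eqF.
by split=> nc beta bpos e1 e2 e1H e2H ne; apply/pairE => //; apply: nc.
Qed.

(** Any set of pivotal edges is a separator: the set of all of them isolates the remaining edges,
    and the singletons make each pivotal edge independent of all others. *)
Lemma nc_delete_pivotal H :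
  nc_system R (edges H) (acyclic (ends H)) <->
  nc_system R (edges (delete_pivotal H)) (acyclic (ends (delete_pivotal H))).
Proof.
have crd : {in edges H, forall e, 0 < #|ends H e| <= 2}%N by move=> e /ends_card.
have bridge e x y : e \in [set e in edges H | pivotal H e] ->
    ends H e = [set x; y] ->
    ~~ connect (edge_rel (ends H) (edges H :\ e)) x y.
  (* [pivotal] provides some disconnected pair of endpoints; it must be [x] and [y] up to order, as
     equal vertices are connected. *)
  rewrite inE => /andP[_ /existsP[a /andP[ae /existsP[b /andP[be nab]]]]] en_e.
  rewrite en_e !inE in ae be; rewrite -[edge_rel _ _]/(adj (del_edges H [set e])).
  case/orP: ae nab => /eqP->; case/orP: be => /eqP->; rewrite ?connect0 //.
  by rewrite -[adj _]/(edge_rel (ends H) (edges H :\ e)) edge_connectC.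
apply: nc_systemD; first exact: acyclic0.
  exact: separator_bridges.
move=> e /setIP[_ eP]; apply: separator_bridges => // f x y /set1P->.
exact: bridge.
Qed.

Lemma nc_suppress_step H H' : suppress_step H H' ->
  nc_system R (edges H) (acyclic (ends H)) <->
  nc_system R (edges H') (acyclic (ends H')).
Proof.
case=> u [e1 [e2 [v1 [v2 [e0 [sup _ [e0S ->] en0 eqS]]]]]].
case/and5P: sup => uH /eqP degu /and3P[e1H e2H e12] /andP[v1u v2u].
case/andP=> /eqP en1 /eqP en2; set S := edges H :\: _ in e0S eqS *.
(* [e1] and [e2] already exhaust the degree of [u], so no other edge meets [u]. *)
have inc : [set e in edges H | u \in ends H e] = [set e1; e2].
  apply/esym/eqP; rewrite eqEcard subUset !sub1set !inE e1H e2H en1 en2 !set21.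
  by rewrite cards2 e12 -degu leq_addr.
have uS (F : {set E}) : F \in powerset S -> {in F, forall e, u \notin ends H e}.
  rewrite powersetE => FS e /(subsetP FS)/setDP[eH]; rewrite -inc inE eH.
  by [].
have -> : edges H = e1 |: (e2 |: S).
  rewrite setUA -[LHS](setID _ [set e1; e2]); congr (_ :|: _); apply/setIidPr.
  by rewrite subUset !sub1set e1H.
have eqF (F : {set E}) : F \in powerset S -> {in F, ends H' =1 ends H}.
  by rewrite powersetE => FS e /(subsetP FS)/eqS.
apply: nc_series.
- exact: e0S.
- by move=> F FS; apply: eq_acyclic => e eF; rewrite (eqF F).
- by move=> F FS; apply/acyclicS/subsetU1.
- by rewrite !inE eqxx.
- by rewrite !inE eqxx orbT.
- exact: e12.
- by move=> F FS; apply: acyclic_leaf v1u en1; apply: uS.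
- by move=> F FS; apply: acyclic_leaf v2u en2; apply: uS.
- move=> F FS; have e0F : e0 \notin F.
    by apply: contraNN e0S; rewrite powersetE in FS; apply: (subsetP FS).
  exact: (acyclic_series (uS F FS) v1u v2u e12 e0F en1 en2 en0 (eqF F FS)).
Qed.

Lemma nc_suppression H Ht : suppression H Ht ->
  nc_system R (edges H) (acyclic (ends H)) <->
  nc_system R (edges Ht) (acyclic (ends Ht)).
Proof.
elim=> [{}H _|{}H H' {}Ht /nc_suppress_step stepE _ IH]; first by split.
exact: iff_trans stepE IH.
Qed.

(** Induction on [#|S|]: a loop is split off, or one of two parallel edges is merged into the other.
    When neither exists, [en] is injective on [S] and only a renaming is left. *)
Lemma nc_simplify en S : {in S, forall e, 0 < #|en e| <= 2}%N ->
  nc_system R S (acyclic en) <->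
  nc_system R (en @: [set e in S | #|en e| != 1%N]) (acyclic id).
Proof.
have [n] := ubnP #|S|; elim: n S => // n IHn S ltn crd.
have IH e : e \in S -> nc_system R (S :\ e) (acyclic en) <->
    nc_system R (en @: [set f in S :\ e | #|en f| != 1%N]) (acyclic id).
  move=> eS; apply: IHn => [|f /setD1P[_ /crd]//].
  by move: ltn; rewrite (cardsD1 e) eS.
case: (pickP [pred e in S | #|en e| == 1%N]) => [e /andP[eS /eqP e1]|noloop].
  rewrite (@nc_systemD R E S _ [set e]); first 1 last.
  - exact: acyclic0.
  - exact: separator_loop.
  - by move=> f /setIP[_ /set1P->]; apply: separator_loop.
  rewrite IH // (_ : [set f in S :\ e | _] = [set f in S | #|en f| != 1%N]) //.
  by apply/setP=> f; rewrite !inE; case: eqVneq => [->|_] /=; rewrite ?e1 ?eqxx ?andbF.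
have -> : [set e in S | #|en e| != 1%N] = S.
  apply/setP=> e; rewrite !inE; have := noloop e => /=.
  by case: (e \in S) => //= ->.
case: (boolP [exists e in S, exists f in S, (e != f) && (en e == en f)]).
  case/existsP=> e /andP[eS /existsP[f /and3P[fS ef /eqP en_ef]]].
  pose D := S :\ e :\ f.
  have eD : e \notin D by rewrite !inE eqxx andbF.
  have fD : f \notin D by rewrite !inE eqxx.
  have DE : D = S :\ f :\ e by rewrite /D !setDDl setUC.
  have eqSf : S :\ f = e |: D by rewrite DE setD1K // !inE ef.
  have eqS : S = e |: (f |: D) by rewrite setUCA -eqSf setD1K.
  rewrite {1}eqS (nc_parallel _ eD fD ef).
  - rewrite -eqSf IH //.
    have -> : [set g in S :\ f | #|en g| != 1%N] = S :\ f.
      apply/setP=> g; rewrite !inE; have := noloop g => /=.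
      by case: (g \in S) => /= [->|]; rewrite ?andbT ?andbF.
    rewrite (_ : en @: (S :\ f) = en @: S) //.
    rewrite -[in RHS](setD1K fS) imsetU1 -en_ef; apply/esym/setUidPr.
    by rewrite sub1set imset_f // !inE ef.
  - move=> F; rewrite powersetE => FD.
    have eF : e \notin F by apply: contraNN eD; apply: (subsetP FD).
    have fF : f \notin F by apply: contraNN fD; apply: (subsetP FD).
    (* [h] replaces [e] by [f], which has the same ends. *)
    pose h g := if g == e then f else g.
    have -> : f |: F = h @: (e |: F).
      rewrite imsetU1 /h eqxx; congr (_ |: _); rewrite -[LHS]imset_id.
      by apply: eq_in_imset => g gF; case: eqVneq gF eF => [-> ->|].
    apply: acyclic_imset => [g1 g2 + +|g _]; last by rewrite /h; case: eqVneq => // ->.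
    have hF g : g \in F -> (g == e) = false /\ (g == f) = false.
      by move=> gF; split; apply: contraTF gF => /eqP->.
    rewrite /h => /setU1P[->|/hF[ge1 gf1]] /setU1P[->|/hF[ge2 gf2]];
      rewrite ?eqxx ?ge1 ?ge2 //.
      by move=> fg; rewrite -fg eqxx in gf2.
    by move=> fg; rewrite fg eqxx in gf1.
  - move=> F FD; apply: (@acyclic_parallel _ _ _ _ e f); rewrite // ?inE ?eqxx ?orbT //.
    exact: crd.
move=> inj; have en_inj : {in S &, injective en}.
  move=> e f eS fS en_ef; apply: contraNeq inj => ef.
  apply/existsP; exists e; rewrite eS.
  by apply/existsP; exists f; rewrite fS ef en_ef eqxx.
apply: nc_system_imset => // F; rewrite powersetE => /subsetP FS.
by apply: acyclic_imset => //; apply: sub_in2 en_inj.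
Qed.

(** The edges inside one component form a separator, so edges of different components are
    independent. *)
Lemma nc_components H :
  nc_system R (edges H) (acyclic (ends H)) <->
  (forall C, C \in component_sets H ->
     nc_system R (edges (induced H C)) (acyclic (ends (induced H C)))).
Proof.
pose A (C : {set V}) := [set e | ends H e \subset C].
have edgesE C : edges (induced H C) = edges H :&: A C.
  by apply/setP=> e; rewrite !inE.
have sep C : C \in component_sets H ->
    separator (edges H) (acyclic (ends H)) (A C).
  case/imsetP=> x _ ->; apply: separator_component => e eH.
  have [a [b en_e]] := card_le2_set2 (ends_card eH).
  have sub := ends_sub eH; rewrite en_e subUset !sub1set in sub.
  case/andP: sub => aH bH.
  have cab : connect (adj H) x a = connect (adj H) x b.
    apply: (same_connect_r (sym_connect_sym (@edge_rel_sym _ _ (ends H) (edges H)))).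
    exact: connect_edge en_e.
  rewrite en_e; case: (boolP (connect (adj H) x a)) => cxa.
    by rewrite subUset !sub1set !inE aH bH -cab cxa.
  rewrite orbC disjoints_subset subUset !sub1set !inE aH bH /= -cab.
  by rewrite (negPf cxa).
split=> [nc C CH|nc beta bpos e1 e2 e1H e2H ne].
  by rewrite edgesE; apply: nc_system_separator (sep C CH) nc; apply: acyclic0.
have [a [b en_e]] := card_le2_set2 (ends_card e1H).
have sub := ends_sub e1H; rewrite en_e subUset !sub1set in sub.
case/andP: sub => aH bH.
(* The component containing [e1]. *)
pose C := [set y in verts H | connect (adj H) a y].
have CH : C \in component_sets H by apply/imsetP; exists a.
have e1C : e1 \in A C.
  rewrite inE en_e subUset !sub1set !inE aH bH connect0.
  exact: connect_edge en_e.
case: (boolP (e2 \in A C)) => e2C; last exact: nc_pair_separated (sep C CH) e1C e2C.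
apply: (nc_pair_within bpos (sep C CH) e1C e2C).
rewrite -edgesE; apply: (nc C CH) => //; rewrite ?edgesE.
- by move=> e /setIP[/bpos].
- by rewrite inE e1H.
- by rewrite inE e2H.
Qed.

End Forests.

Theorem theorem2p6 (R : realType) (V E : finType) (G Gt : mgraph V E) :
  connected_graph G ->
  suppression (delete_pivotal G) Gt ->
  always_negative_correlation R G <->
  (forall C : {set V}, C \in component_sets (remove_mult Gt) ->
     always_negative_correlation R (induced (remove_mult Gt) C)).
Proof.
move=> _ /(nc_suppression R) supp.
rewrite always_negative_correlationE nc_delete_pivotal supp.
rewrite nc_simplify; last by move=> e /ends_card.
rewrite (_ : _ @: _ = edges (remove_mult Gt)) //.
rewrite (nc_components R (remove_mult Gt)).
by split=> nc C /nc /always_negative_correlationE.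
Qed.
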